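(* Let $K\ge 1$ and $d\ge 1$ be integers. There is a constant $q_0=q_0(K,d)$ such that the following holds for every finite field $\mathbb{F}$ with $|\mathbb{F}|\ge q_0$. Let $\mathbb{V}_1,\dots,\mathbb{V}_d,\mathbb{U}$ be finite-dimensional vector spaces over $\mathbb{F}$, let $\mathbb{V}=\mathbb{V}_1\times\dots\times\mathbb{V}_d$, and let $g:\mathbb{V}\to\mathbb{U}$ be a non-zero multilinear map (linear in each of its $d$ arguments), so that $\deg g=d$. Let $f(X_1,\dots,X_K)=g(X_1)+\dots+g(X_K)$ for $X_1,\dots,X_K\in\mathbb{V}$. Then every valid data-private scheme for $f$ that uses linear encoding functions (with an arbitrary, not necessarily linear, decoding function) uses at least $K(d-1)+2$ workers.
   Context: **Computing schemes.** A scheme with $N$ workers for $f$ consists of (possibly random) encoding functions $h_1,\dots,h_N:\mathbb{V}^K\to\mathbb{V}$ (which may share randomness; the randomness is independent of the dataset) and a (possibly random) decoding function $\ell:\mathbb{U}^N\to\mathbb{U}$ whose randomness is independent of the encoding functions. Worker $i$ stores $\tilde X_i=h_i(X_1,\dots,X_K)\in\mathbb{V}$ and returns $g(\tilde X_i)$. The master outputs $\ell(g(\tilde X_1),\dots,g(\tilde X_N))$. - The scheme is *valid* if for every dataset $(X_1,\dots,X_K)\in\mathbb{V}^K$ the master's output always equals $f(X_1,\dots,X_K)$. - The scheme is *data-private* if for every individual worker $i$ and every probability distribution of $(X_1,\dots,X_K)$ on $\mathbb{V}^K$, the mutual information satisfies $I(X_1,\dots,X_K;\tilde X_i)=0$.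 - The scheme *uses linear encoding functions* if each $\tilde X_i$ is a linear combination, with coefficients in $\mathbb{F}$, of $X_1,\dots,X_K$ and a list of independent uniformly random keys in $\mathbb{V}$ (shared by all workers). *)

(* Defs.v *)
From HB Require Import structures.
From mathcomp Require Import all_boot all_order all_algebra all_field.
From mathcomp Require Import reals exp.

Set Implicit Arguments.
Unset Strict Implicit.
Unset Printing Implicit Defensive.

Import Order.TTheory GRing.Theory Num.Theory.
Local Open Scope ring_scope.

Section FiniteProbability.
Variable R : realType.

Record fdist (A : finType) := FDist {
  pmf :> A -> R;
  pmf_ge0 : forall a, 0 <= pmf a;
  pmf_sum1 : \sum_a pmf a = 1 }.

Definition Pr (A : finType) (P : fdist A) (E : pred A) : R := \sum_(a | E a) P a.

Section Unif.
Variables (A : finType) (A_gt0 : (0 < #|A|)%N).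

Fact unif_ge0 (a : A) : 0 <= #|A|%:R^-1 :> R.
Proof. by rewrite invr_ge0 ler0n. Qed.

Fact unif_sum1 : \sum_(a : A) #|A|%:R^-1 = 1 :> R.
Proof.
by rewrite sumr_const -[_ *+ _]mulr_natl divff // pnatr_eq0 -lt0n.
Qed.

Definition fdist_unif : fdist A := FDist unif_ge0 unif_sum1.
End Unif.

Section Map.
Variables (A B : finType) (h : A -> B) (P : fdist A).

Fact map_ge0 b : 0 <= Pr P (fun a => h a == b).
Proof. by apply: sumr_ge0 => a _; apply: pmf_ge0. Qed.

Fact map_sum1 : \sum_b Pr P (fun a => h a == b) = 1.
Proof. by rewrite -[RHS](pmf_sum1 P) (partition_big h predT). Qed.

(* The law of the random variable h under P. *)
Definition fdist_map : fdist B := FDist map_ge0 map_sum1.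
End Map.

Section Prod.
Variables (A B : finType) (P : fdist A) (Q : fdist B).

Fact prod_ge0 (p : A * B) : 0 <= P p.1 * Q p.2.
Proof. by rewrite mulr_ge0 ?pmf_ge0. Qed.

Fact prod_sum1 : \sum_(p : A * B) P p.1 * Q p.2 = 1.
Proof.
rewrite -(pair_bigA _ (fun a b => P a * Q b)) /= -[RHS](pmf_sum1 P).
by apply: eq_bigr => a _; rewrite -mulr_sumr pmf_sum1 mulr1.
Qed.

(* The joint law of independent variables with laws P and Q. *)
Definition fdist_prod : fdist (A * B)%type := FDist prod_ge0 prod_sum1.
End Prod.

(* In nats; terms with P p = 0 vanish, which is the convention 0 ln 0 = 0. *)
Definition mutual_info (A B : finType) (P : fdist (A * B)%type) : R :=
  \sum_p P p * ln (P p / (fdist_map fst P p.1 * fdist_map snd P p.2)).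

End FiniteProbability.

Section Schemes.
Variables (R : realType) (V U : finType) (K N : nat).

Definition dataset := {ffun 'I_K -> V}.

(* Every type involved is finite, so random functions are given by their law
   on the finite set of functions.  enc is the joint law of (h_1, ..., h_N):
   the encoders may share randomness.  Keeping enc and dec as two separate laws
   makes the decoder independent of the encoders, and independence of the
   dataset is obtained below by taking product laws. *)
Record scheme := Scheme {
  enc : fdist R {ffun 'I_N -> {ffun dataset -> V}};
  dec : fdist R {ffun {ffun 'I_N -> U} -> U} }.

Definition valid (g : V -> U) (f : dataset -> U) (S : scheme) : Prop :=
  forall X : dataset,
    Pr (fdist_prod (enc S) (dec S))
       (fun hl => hl.2 [ffun i => g (hl.1 i X)] == f X) = 1.

Definition data_private (S : scheme) : Prop :=
  forall (i : 'I_N) (D : fdist R dataset),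
    mutual_info
      (fdist_map
         (fun Xh : dataset * {ffun 'I_N -> {ffun dataset -> V}} =>
            (Xh.1, Xh.2 i Xh.1))
         (fdist_prod D (enc S))) = 0.

End Schemes.

(* V_1 x ... x V_d; finvect_type W is W itself, with its finType structure. *)
Notation prodV V := {dffun forall j, finvect_type (V j)}.

Section Linear.
Variables (F : finFieldType) (d : nat) (V : 'I_d -> vectType F).

Definition multilinear (U : vectType F) (g : prodV V -> finvect_type U) : Prop :=
  forall (j : 'I_d) (v : prodV V),
    linear (fun x : finvect_type (V j) => g (finfun (dfwith v x))).

Variables (R : realType) (U : finType) (K N : nat).

(* X~_i = sum_k a_ik X_k + sum_t b_it Z_t, written componentwise in V. *)
Definition linear_encoder (T : nat) (a : 'M[F]_(N, K)) (b : 'M[F]_(N, T))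
    (Z : {ffun 'I_T -> prodV V}) : {ffun 'I_N -> {ffun dataset (prodV V) K -> prodV V}} :=
  [ffun i => [ffun X : dataset (prodV V) K =>
    finfun (fun j => \sum_k a i k *: X k j + \sum_t b i t *: Z t j)]].

Fact keys_gt0 (T : nat) : (0 < #|{: {ffun 'I_T -> prodV V}}|)%N.
Proof. by apply/card_gt0P; exists [ffun=> finfun (fun j => 0)]. Qed.

(* Z_1, ..., Z_T are independent and uniform on V exactly when (Z_1, ..., Z_T)
   is uniform on V^T. *)
Definition uses_linear_encoding (S : scheme R (prodV V) U K N) : Prop :=
  exists (T : nat) (a : 'M[F]_(N, K)) (b : 'M[F]_(N, T)),
    enc S =1 fdist_map (linear_encoder a b) (fdist_unif R (keys_gt0 T)).

End Linear.

(* Main.v *)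
Require Import Defs.
From HB Require Import structures.
From mathcomp Require Import all_boot all_order all_algebra all_field.
From mathcomp Require Import reals exp.
From mathcomp Require Import zify.

Import Order.TTheory GRing.Theory Num.Theory.
Local Open Scope ring_scope.

(* Fix v with g v <> 0 and restrict every variable to multiples of the v_j.
   Worker i then returns \prod_j L_i(s_j) times g v, where L_i is the i-th row
   of [a | b] and s_j holds the coordinates of the data and keys in V_j, while
   the master wants \sum_k \prod_j s_j(k).  Privacy says that a nonzero L_i is
   not supported on the data coordinates.  If N <= K (d - 1) + 1, one can choose
   s_1, ..., s_(d-1), all nonzero at a common data coordinate, such that at most
   one L_i vanishes at none of them: by induction on d, each choice of s_j kills
   enough workers for the numbers of surviving workers and of surviving data
   coordinates to satisfy the same inequality with d - 1.  A suitable last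
   argument s_d kills the remaining worker but not the sum, so the master cannot
   tell this input from the one with s_d = 0. *)

(** * Generic kernel vectors and exchange over a finite field *)

Local Notation unit_row k := (delta_mx (0 : 'I_1) k).

(** Induction on [#|M|]: if the unit row of [k0] lies outside the row space of [A], some kernel
    vector [t] is nonzero at [k0], and adding a suitable multiple of [t] to the previous [s] loses
    no coordinate already secured. *)
Lemma generic_annihilator (F : finFieldType) m n (A : 'M[F]_(m, n)) (M : {set 'I_n}) :
  (#|M| < #|F|)%N ->
  exists s : 'cV[F]_n, A *m s = 0 /\
    forall k, k \in M -> ~~ (unit_row k <= A)%MS -> s k 0 != 0.
Proof.
have [c] := ubnP #|M|; elim: c M => // c IH M leMc ltMF.
have [->|[k0 k0M]] := set_0Vmem M.
  by exists 0; split=> [|k]; rewrite ?mulmx0 ?inE.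
have cM : #|M| = #|M :\ k0|.+1 by rewrite (cardsD1 k0) k0M.
have [||s [As0 sP]] := IH (M :\ k0); [by move: leMc; rewrite cM | by lia | ].
have [k0A|k0A] := boolP (unit_row k0 <= A)%MS.
  exists s; split=> // k kM kA; apply: sP => //.
  by rewrite !inE kM andbT; apply: contraNneq kA => ->.
have [t [At0 tk0]] : exists t : 'cV[F]_n, A *m t = 0 /\ t k0 0 != 0.
  move: k0A; rewrite submxE -rowE => /rV0Pn[j]; rewrite mxE => h.
  by exists (col j (cokermx A)); rewrite colE mulmxA mulmx_coker mul0mx -colE mxE.
(* Each [k] in [M] excludes at most one multiplier, so fewer than [#|F|] in all. Where [t k 0 = 0]
   the entry of [s] does not change, and the value put into [bad] is harmless. *)
pose bad := [set - s k 0 / t k 0 | k in M].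
have [x xbad] : exists x, x \notin bad.
  apply/existsP; rewrite -negb_forall; apply/negP => /forallP h.
  have : (#|F| <= #|bad|)%N by apply/subset_leq_card/subsetP => y _; apply: h.
  by rewrite leqNgt (leq_ltn_trans (leq_imset_card _ _)).
exists (s + x *: t); split=> [|k kM kA].
  by rewrite mulmxDr -scalemxAr As0 At0 scaler0 addr0.
rewrite !mxE; apply/negP; rewrite addrC addr_eq0 => /eqP xtE.
have [tk|tk] := eqVneq (t k 0) 0.
  have kk0 : k != k0 by apply: contraNneq tk0 => <-; rewrite tk.
  have := sP k; rewrite !inE kk0 kM => /(_ isT kA).
  by rewrite -oppr_eq0 -xtE tk mulr0 eqxx.
by move/negP: xbad; apply; apply/imsetP; exists k => //; rewrite -xtE mulfK.
Qed.

(** Steinitz exchange: adjoining [v] raises the rank by at most one, and adjoining [u] already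
    raises it. Canonical generators turn equal row spaces into equal matrices, which can then label
    classes. *)
Lemma genmx_exchange (F : fieldType) m n (A : 'M[F]_(m, n)) (u v : 'rV[F]_n) :
  (u <= A + v)%MS -> ~~ (u <= A)%MS -> <<(A + u)%MS>>%MS = <<(A + v)%MS>>%MS.
Proof.
move=> uAv uA.
have sub : (A + u <= A + v)%MS by rewrite addsmx_sub addsmxSl.
apply/genmxP; rewrite sub /=; have [_ <-] := mxrank_leqif_sup sub.
rewrite eqn_leq mxrankS //=.
apply: leq_trans (mxrank_adds_leqif A v) _.
have ltA : (A < A + u)%MS.
  by rewrite /ltmx addsmxSl; apply: contra uA; apply: submx_trans; apply: addsmxSr.
by have := rank_leq_row v; move: ltA; rewrite ltmxErank => /andP[_]; lia.
Qed.

(** * Killing rows by one vector that keeps many data coordinates *)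

Section Killing.
Variables (F : finFieldType) (N n : nat) (L : 'M[F]_(N, n)) (D : {set 'I_n}).
Hypothesis ltDF : (#|D| < #|F|)%N.
Hypothesis privL : forall i, row i L != 0 -> exists2 t, t \notin D & L i t != 0.

Lemma rank_coordinates (M : {set 'I_n}) (A : 'M[F]_n) :
  (forall k, k \in M -> (unit_row k <= A)%MS) -> (#|M| <= \rank A)%N.
Proof.
move=> MA; pose B : 'M[F]_(#|M|, n) := rowsub (fun j => enum_val j) 1%:M.
have BA : (B <= A)%MS.
  by apply/row_subP => j; rewrite row_rowsub row1 MA ?enum_valP.
apply: leq_trans (mxrankS BA); apply: eq_leq; apply/esym/eqP.
rewrite -[_ == _]/(row_free B); apply/row_freeP; exists B^T.
apply/matrixP=> i j; rewrite !mxE (bigD1 (enum_val i)) //= big1 ?addr0.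
  by rewrite !mxE eqxx mul1r (inj_eq enum_val_inj) eq_sym.
by move=> k ki; rewrite !mxE eq_sym (negPf ki) mul0r.
Qed.

(** If [A] contained all unit rows of [M], the rank bound would make it their span, so [row i L]
    would be supported on [D], against [privL]. *)
Lemma coordinates_not_sub (M : {set 'I_n}) (A : 'M[F]_n) i :
  M \subset D -> (\rank A <= #|M|)%N -> row i L != 0 -> (row i L <= A)%MS ->
  exists2 k, k \in M & ~~ (unit_row k <= A)%MS.
Proof.
move=> MD rA Li LiA; apply/exists_inP; rewrite -[X in is_true X]negbK negb_exists_in.
apply/negP => /forall_inP h.
have MA k : k \in M -> (unit_row k <= A)%MS by move/h; rewrite negbK.
have [t tD Lit] := privL _ Li.
pose B : 'M[F]_n := (\sum_(k in M) <<unit_row k>>)%MS.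
have BA : (B <= A)%MS by apply/sumsmx_subP => k kM; rewrite genmxE MA.
have MB k : k \in M -> (unit_row k <= B)%MS.
  by move=> kM; rewrite (sumsmx_sup k) // genmxE.
have AB : (A <= B)%MS.
  by have [_ <-] := mxrank_leqif_sup BA; rewrite eqn_leq mxrankS //=
    (leq_trans rA) ?rank_coordinates.
have Bt : B *m delta_mx t (0 : 'I_1) = 0.
  apply/sub_kermxP/sumsmx_subP => k kM; rewrite genmxE; apply/sub_kermxP.
  rewrite mul_delta_mx_0 //; apply: contraNneq tD => <-; exact: (subsetP MD).
have /submxP[u Lu] := submx_trans LiA AB.
move/eqP: Lit; apply.
have -> : L i t = (row i L *m delta_mx t (0 : 'I_1)) 0 0.
  by rewrite -colE !mxE.
by rewrite Lu -mulmxA Bt mulmx0 mxE.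
Qed.

Section Step.
Variables (M : {set 'I_n}) (I : {set 'I_N}) (p : nat).
Hypotheses (MD : M \subset D) (M0 : M != set0).

Definition rows_in (A : 'M[F]_n) := [set i in I | (row i L <= A)%MS].
Definition coords_in (A : 'M[F]_n) := [set k in M | (unit_row k <= A)%MS].

(* The subspaces A + row i L partition the rows outside A; compare the numbers of
   surviving rows and coordinates class by class. *)
Lemma stuck_bound (A : 'M[F]_n) (s : 'cV[F]_n) :
  A *m s = 0 ->
  (forall i, i \in I -> ~~ (row i L <= A)%MS ->
     #|rows_in (A + row i L)%MS| - #|rows_in A| <=
     p * (#|coords_in (A + row i L)%MS| - #|coords_in A|))%N ->
  (forall k, k \in M -> ~~ (unit_row k <= A)%MS -> s k 0 != 0) ->
  (#|[set i in I | (L *m s) i 0%R != 0%R]| <= p * #|[set k in M | s k 0%R != 0%R]|)%N.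
Proof.
move=> As0 stuck gen.
have LsE i : (L *m s) i 0 = (row i L *m s) 0 0 by rewrite -row_mul [RHS]mxE.
have outA i : (L *m s) i 0 != 0 -> ~~ (row i L <= A)%MS.
  by rewrite LsE; apply: contraNN => /submxP[u ->]; rewrite -mulmxA As0 mulmx0 mxE.
pose cls (v : 'rV[F]_n) := <<(A + v)%MS>>%MS.
rewrite -!sum1_card big_distrr /=.
rewrite (partition_big (fun i => cls (row i L)) predT) //=.
rewrite [X in (_ <= X)%N](partition_big (fun k => cls (unit_row k)) predT) //=.
apply: leq_sum => B _.
rewrite -big_distrr /= !sum1_card.
have [/existsP[i0 /andP[]]|] := boolP [exists i,
    (i \in [set i in I | (L *m s) i 0 != 0]) && (cls (row i L) == B)].
  rewrite inE => /andP[i0I Lsi0] /eqP clsi0.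
  have BE : (B :=: A + row i0 L)%MS by rewrite -clsi0; apply: genmxE.
  have i0A := outA _ Lsi0.
  apply: leq_trans (leq_trans (stuck i0 i0I i0A) _).
    rewrite -cardsDS; last first.
      apply/subsetP => i; rewrite !inE => /andP[-> /submx_trans->] //.
      exact: addsmxSl.
    apply/subset_leq_card/subsetP => i; rewrite unfold_in !inE.
    case/andP => /andP[iI Lsi] /eqP clsi; rewrite iI outA //=.
    by rewrite -BE -clsi genmxE addsmxSr.
  rewrite leq_mul2l -cardsDS ?orbT //; last first.
    apply/subsetP => i; rewrite !inE => /andP[-> /submx_trans->] //.
    exact: addsmxSl.
  (* A coordinate gained by adjoining [row i0 L] has class [B] by exchange, and [s] is nonzero there
     by genericity. *)
  apply/orP; right; apply/subset_leq_card/subsetP => k.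
  rewrite !inE negb_and => /andP[/orP[kM'|kA] /andP[kM kAi]].
    by rewrite kM in kM'.
  rewrite unfold_in !inE kM gen //=.
  by rewrite -clsi0; apply/eqP/genmx_exchange.
rewrite negb_exists => /forallP h; rewrite eq_card0 // => i.
by apply/negbTE; rewrite unfold_in.
Qed.

(* Grow a row space A by adjoining rows of L as long as A contains at least
   \rank A + p * #|coords_in A| of the rows in I.  Either the rank reaches #|M|,
   and then A cannot contain all coordinates in M by privacy, or A is stuck and
   stuck_bound applies; in both cases s is generic in the annihilator of A. *)
Lemma annihilator_step :
  (#|I| <= #|M| * p.+1 + 1)%N ->
  exists s : 'cV[F]_n, (exists2 k, k \in M & s k 0 != 0) /\
    (#|[set i in I | (L *m s) i 0%R != 0%R]| <= #|[set k in M | s k 0%R != 0%R]| * p + 1)%N.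
Proof.
move=> leI; set goal := ex _.
have ltMF : (#|M| < #|F|)%N := leq_ltn_trans (subset_leq_card MD) ltDF.
(* The last clause supplies the nonzero row that [coordinates_not_sub] needs; at [r = #|M|] the case
   [r = 0] is excluded by [M0]. *)
have grow r : (r <= #|M|)%N ->
    (exists A : 'M[F]_n, [/\ (\rank A <= r)%N,
       (r + p * #|coords_in A| <= #|rows_in A|)%N &
       r = 0%N \/ exists2 i, row i L != 0 & (row i L <= A)%MS]) \/ goal.
  elim: r => [_|r IH ltrM].
    left; exists 0; split; rewrite ?mxrank0 ?add0n //; last by left.
    rewrite (_ : coords_in 0 = set0) ?cards0 ?muln0 //.
    apply/setP => k; rewrite !inE submx0; apply/negP => /andP[_ /eqP/rowP/(_ k)].
    by rewrite !mxE !eqxx => /eqP; rewrite oner_eq0.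
  have [[A [rA wA _]]|] := IH (ltnW ltrM); last by right.
  have [/existsP[i /and3P[iI iA wi]]|stuck] := boolP [exists i, [&& i \in I,
      ~~ (row i L <= A)%MS &
      (p * (#|coords_in (A + row i L)%MS| - #|coords_in A|) <
       #|rows_in (A + row i L)%MS| - #|rows_in A|)%N]].
    left; exists (A + row i L)%MS; split.
    - apply: leq_trans (mxrank_adds_leqif A (row i L)) _.
      by have := rank_leq_row (row i L); lia.
    - nia.
    - right; exists i; last exact: addsmxSr.
      by apply: contraNneq iA => ->; apply: sub0mx.
  right; have [s [As0 gen]] := generic_annihilator _ _ _ A M ltMF.
  exists s; split.
    (* Here [\rank A <= r < #|M|], so [A] misses some coordinate of [M]. *)
    have [/forall_inP MA|] := boolP [forall k in M, unit_row k <= A]%MS.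
      by have := rank_coordinates _ _ MA; lia.
    by rewrite negb_forall_in => /exists_inP[k kM kA]; exists k => //; apply: gen.
  rewrite mulnC; apply: leq_trans (leq_addr 1 _); apply: stuck_bound As0 _ gen.
  move=> i iI iA; rewrite leqNgt; apply: contra stuck => wi.
  by apply/existsP; exists i; rewrite iI iA.
have [[A [rA wA]]|//] := grow _ (leqnn _).
case=> [/eqP|[i Li LiA]]; first by rewrite cards_eq0 (negPf M0).
have [s [As0 gen]] := generic_annihilator _ _ _ A M ltMF.
have [k kM kA] := coordinates_not_sub _ _ _ MD rA Li LiA.
exists s; split; first by exists k => //; apply: gen.
(* With [c = #|coords_in A|], at least [#|M| + p * c] rows of [I] are killed, leaving at most
   [p * (#|M| - c) + 1], while at least [#|M| - c] coordinates survive. *)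
have le1 : (#|[set i in I | (L *m s) i 0%R != 0%R]| <= #|I :\: rows_in A|)%N.
  apply/subset_leq_card/subsetP => j; rewrite !inE => /andP[-> Lsj]; rewrite andbT /=.
  apply: contraNN Lsj => /submxP[u Lju].
  have -> : (L *m s) j 0 = (row j L *m s) 0 0 by rewrite -row_mul [RHS]mxE.
  by rewrite Lju -mulmxA As0 mulmx0 mxE.
have le2 : (#|M :\: coords_in A| <= #|[set k in M | s k 0%R != 0%R]|)%N.
  apply/subset_leq_card/subsetP => j; rewrite !inE andbC => /andP[jM]; rewrite jM /=.
  exact: gen.
have eI : #|I :\: rows_in A| = (#|I| - #|rows_in A|)%N.
  by rewrite cardsDS //; apply/subsetP => j; rewrite inE => /andP[].
have sM : coords_in A \subset M by apply/subsetP => j; rewrite inE => /andP[].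
have eM := cardsDS sM; have := subset_leq_card sM.
nia.
Qed.

End Step.

End Killing.

(** * Killing all rows by several vectors *)

(** Induction on [p]: each vector replaces [I] by its surviving rows and [M] by its support in [M],
    so a coordinate of the last [M] is nonzero in all vectors. [D] stays fixed, so [privL] still
    applies. *)
Lemma annihilators (F : finFieldType) N n (L : 'M[F]_(N, n)) (D M : {set 'I_n})
    (I : {set 'I_N}) p :
  (#|D| < #|F|)%N ->
  (forall i, row i L != 0 -> exists2 t, t \notin D & L i t != 0) ->
  M \subset D -> M != set0 -> (#|I| <= #|M| * p + 1)%N ->
  exists (ss : seq 'cV[F]_n) (k : 'I_n),
    [/\ size ss = p, k \in M, all (fun s : 'cV[F]_n => s k 0 != 0) ss &
     (#|[set i in I | all (fun s : 'cV[F]_n => (L *m s) i 0%R != 0%R) ss]| <= 1)%N].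
Proof.
move=> ltDF privL; elim: p M I => [|p IH] M I MD M0 leI.
  have [k kM] := set0Pn _ M0.
  exists [::], k; split=> //=; move: leI; rewrite muln0; apply: leq_trans.
  by apply/subset_leq_card/subsetP => i; rewrite inE => /andP[].
have [s [[k0 k0M sk0] leI']] := annihilator_step _ _ _ _ _ ltDF privL _ _ _ MD M0 leI.
have [| |ss [k [sz kM' ssk le1]]] := IH _ _ _ _ leI'.
- by apply: subset_trans MD; apply/subsetP => k; rewrite inE => /andP[].
- by apply/set0Pn; exists k0; rewrite inE k0M.
move: kM'; rewrite inE => /andP[kM sk].
exists (s :: ss), k; split; rewrite //= ?sz ?sk //.
apply: leq_trans le1; apply/subset_leq_card/subsetP => i.
by rewrite !inE andbA.
Qed.

(** At most one row survives [annihilators]; the last vector [y] has to kill it while agreeing with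
    a unit vector on [D]. *)
Lemma fooling_vectors (F : finFieldType) N n (L : 'M[F]_(N, n)) (D : {set 'I_n}) p :
  (#|D| < #|F|)%N ->
  (forall i, row i L != 0 -> exists2 t, t \notin D & L i t != 0) ->
  D != set0 -> (N <= #|D| * p + 1)%N ->
  exists (ss : seq 'cV[F]_n) (y : 'cV[F]_n) (k : 'I_n),
    [/\ size ss = p, k \in D, all (fun s : 'cV[F]_n => s k 0 != 0) ss,
     forall k', k' \in D -> y k' 0 = (k' == k)%:R &
     forall i, (\prod_(s <- ss) (L *m s) i 0) * (L *m y) i 0 = 0].
Proof.
move=> ltDF privL D0 leN; have [|ss [k [sz kD ssk]]] :=
  annihilators _ _ _ L D D setT p ltDF privL (subxx _) D0.
  by rewrite cardsT card_ord.
set J := [set i in _ | _] => leJ.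
have nJ (y : 'cV[F]_n) i : i \notin J -> (\prod_(s <- ss) (L *m s) i 0) * (L *m y) i 0 = 0.
  rewrite !inE /= -has_predC => /hasP[s sss /=]; rewrite negbK => /eqP Ls0.
  by rewrite (big_rem s) //= Ls0 !mul0r.
pose e : 'cV[F]_n := delta_mx k 0.
have De k' : e k' 0 = (k' == k)%:R by rewrite mxE eqxx andbT.
have LeE i : (L *m e) i 0 = L i k by rewrite -colE mxE.
have [J0|[i iJ]] := set_0Vmem J.
  by exists ss, e, k; split=> // i; apply: nJ; rewrite J0 inE.
have J1 i' : i' != i -> i' \notin J.
  apply: contra => i'J; have /card_le1_eqP := leJ; move=> /(_ i' i i'J iJ) ->.
  exact: eqxx.
have [Li0|/privL[t tD Lit]] := eqVneq (row i L) 0.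
  exists ss, e, k; split=> // i'; have [->|/J1/nJ//] := eqVneq i' i.
  by rewrite LeE; move/rowP/(_ k): Li0; rewrite !mxE => ->; rewrite mulr0.
(* The correction sits at a coordinate [t] outside [D], so the entries on [D] are kept; its
   coefficient cancels [L i k]. *)
exists ss, (e - (L i k / L i t) *: delta_mx t 0), k; split=> //.
  move=> k' k'D; rewrite mxE De !mxE eqxx andbT.
  have -> : (k' == t) = false by apply: contraNF tD => /eqP <-.
  by rewrite mulr0 subr0.
move=> i'; have [->|/J1/nJ//] := eqVneq i' i.
by rewrite mulmxBr -scalemxAr -(colE t) [X in _ * X]mxE LeE !mxE divfK // subrr mulr0.
Qed.

(** * Finite probability and vanishing mutual information *)

Section Probability.
Variable R : realType.

Lemma fdist_ex (A : finType) (P : fdist R A) : exists a, P a != 0.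
Proof.
apply/existsP; rewrite -negb_forall; apply/negP => /forallP P0.
have := pmf_sum1 P; rewrite big1 => [/eqP|a _]; last exact/eqP.
by rewrite eq_sym oner_eq0.
Qed.

Lemma Pr_eq1 (A : finType) (P : fdist R A) (E : pred A) a :
  Pr P E = 1 -> P a != 0 -> E a.
Proof.
move=> PE; apply: contraNT => nEa.
have := pmf_sum1 P; rewrite (bigID E) /= -/(Pr P E) PE => /eqP.
rewrite -subr_eq0 addrAC subrr add0r psumr_eq0 => [/allP/(_ a)|? _]; last exact: pmf_ge0.
by rewrite mem_index_enum nEa => /(_ isT).
Qed.

Lemma Pr_neq0 (A : finType) (P : fdist R A) (E : pred A) :
  reflect (exists2 a, E a & P a != 0) (Pr P E != 0).
Proof.
rewrite /Pr psumr_eq0 => [|? _]; last exact: pmf_ge0.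
rewrite -has_predC; apply: (iffP hasP) => [[a _ /=]|[a Ea Pa]].
  by rewrite negb_imply => /andP[? ?]; exists a.
by exists a; rewrite ?mem_index_enum //= negb_imply Ea.
Qed.

Lemma fdist_map_neq0 (A B : finType) (h : A -> B) (P : fdist R A) b :
  reflect (exists2 a, h a = b & P a != 0) (fdist_map h P b != 0).
Proof.
by apply: (iffP (Pr_neq0 _ _ _)) => -[a /eqP]; exists a => //; apply/eqP.
Qed.

Lemma fdist_le1 (A : finType) (P : fdist R A) a : P a <= 1.
Proof.
rewrite -(pmf_sum1 P) (bigD1 a) //= lerDl; apply: sumr_ge0 => *; exact: pmf_ge0.
Qed.

(* When the first component determines the second, I(A; B) = H(B). *)
Lemma mutual_info_det_eq0 (A B : finType) (P : fdist R (A * B)%type) (phi : A -> B) :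
  (forall p, P p != 0 -> p.2 = phi p.1) -> mutual_info P = 0 ->
  forall p q, P p != 0 -> P q != 0 -> p.2 = q.2.
Proof.
move=> det I0.
pose P2 := fdist_map snd P.
have P1E p : P p != 0 -> fdist_map fst P p.1 = P p.
  move=> Pp; rewrite /= /Pr (bigD1 p) //= big1 ?addr0 // => q /andP[/eqP qp1 qp].
  apply/eqP; apply: contraNT qp => Pq.
  by apply/eqP; case: p q Pp Pq qp1 => [a b] [a' b'] /det /= -> /det /= -> ->.
have P2p p : P p != 0 -> P2 p.2 != 0 by move=> Pp; apply/fdist_map_neq0; exists p.
have P2gt0 p : P p != 0 -> 0 < P2 p.2 by move=> Pp; rewrite lt_def P2p ?pmf_ge0.
(* Every term is thus nonnegative, and a zero sum forces mass one on each value of the second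
   component that occurs. *)
have termE p : P p != 0 ->
    P p * ln (P p / (fdist_map fst P p.1 * fdist_map snd P p.2)) = P p * ln (P2 p.2)^-1.
  by move=> Pp; rewrite P1E // invfM mulrA divff // mul1r.
have term_ge0 p : 0 <= P p * ln (P p / (fdist_map fst P p.1 * fdist_map snd P p.2)).
  have [->|Pp] := eqVneq (P p) 0; first by rewrite mul0r.
  rewrite termE // mulr_ge0 ?pmf_ge0 // ln_ge0 //.
  by rewrite invf_ge1 ?P2gt0 // fdist_le1.
have P21 p : P p != 0 -> P2 p.2 = 1.
  move=> Pp; move/eqP: I0; rewrite /mutual_info psumr_eq0 // => /allP/(_ p).
  rewrite mem_index_enum termE // => /(_ isT); rewrite mulf_eq0 (negPf Pp) /=.
  by rewrite ln_eq0 ?invr_gt0 ?P2gt0 // invr_eq1 => /eqP.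
move: (P2) P21 => Q Q1 p q Pp Pq; apply/eqP; apply: contraT => npq.
have := pmf_sum1 Q; rewrite (bigD1 p.2) //= (bigD1 q.2) 1?eq_sym //= => /eqP.
rewrite (Q1 _ Pp) (Q1 _ Pq) -subr_eq0 addrAC subrr add0r.
rewrite paddr_eq0 ?ler01 ?oner_eq0 //; apply: sumr_ge0 => b _; exact: pmf_ge0.
Qed.

End Probability.

(** * Multilinear maps and consequences of validity and privacy *)

Section Schemes.
Variables (F : finFieldType) (d : nat) (V : 'I_d -> vectType F).

(** The arguments are scaled one at a time: [c' r] scales the first [r] and leaves the others
    alone. *)
Lemma multilinear_scale (U : vectType F) (g : prodV V -> finvect_type U)
    (c : 'I_d -> F) (v : prodV V) :
  multilinear g ->
  g (finfun (fun j => c j *: v j)) = (\prod_j c j) *: g v.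
Proof.
move=> gL.
pose c' r (j : 'I_d) := if (j < r)%N then c j else 1.
suff H r : (r <= d)%N -> g (finfun (fun j => c' r j *: v j)) = (\prod_j c' r j) *: g v.
  have cE j : c' d j = c j by rewrite /c' ltn_ord.
  transitivity (g (finfun (fun j => c' d j *: v j))).
    by congr (g _); apply/ffunP => j; rewrite !ffunE cE.
  by rewrite H //; congr (_ *: _); apply: eq_bigr => j _; rewrite cE.
elim: r => [_|r IH ltrd].
  rewrite big1 // scale1r; congr (g _); apply/ffunP => j.
  by rewrite ffunE /c' ltn0 scale1r.
pose j0 := Ordinal ltrd; pose w : prodV V := finfun (fun j => c' r j *: v j).
have c'E j : c' r.+1 j = if j == j0 then c j0 else c' r j.
  rewrite /c' ltnS leq_eqVlt -[j == j0]/(j == r :> nat).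
  case: (altP (j =P j0)) => [->|jj0]; first by rewrite /= eqxx.
  by rewrite -[(j == r :> nat)]/(j == j0) (negPf jj0).
have wE a : finfun (fun j => (if j == j0 then a else c' r j) *: v j) =
    finfun (dfwith w (a *: v j0)) :> prodV V.
  apply/ffunP => j; rewrite !ffunE.
  have [->|jj0] := eqVneq j j0; first by rewrite dfwith_in.
  by rewrite dfwith_out 1?eq_sym // ffunE.
have gZ a : g (finfun (dfwith w (a *: v j0))) = a *: g (finfun (dfwith w (v j0))).
  pose h (x : finvect_type (V j0)) := g (finfun (dfwith w x)).
  have hL : linear h := gL j0 w.
  have h0 : h 0 = 0 by have := hL (-1) 0 0; rewrite scaler0 addr0 scaleN1r addNr.
  by have := hL a (v j0) 0; rewrite -/(h _) !addr0 h0 addr0.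
have -> : finfun (fun j => c' r.+1 j *: v j) = finfun (dfwith w (c j0 *: v j0)) :> prodV V.
  by rewrite -wE; apply/ffunP => j; rewrite !ffunE c'E.
rewrite gZ -[v j0]scale1r -wE.
have -> : finfun (fun j => (if j == j0 then 1 else c' r j) *: v j) = w.
  apply/ffunP => j; rewrite !ffunE.
  by have [->|//] := eqVneq; rewrite /c' ltnn.
rewrite (IH (ltnW ltrd)) scalerA; congr (_ *: _).
rewrite (bigD1 j0) //= [RHS](bigD1 j0) //= c'E eqxx {1}/c' ltnn mul1r.
by congr (_ * _); apply: eq_bigr => j /negPf jj0; rewrite c'E jj0.
Qed.

Variables (R : realType) (U : finType) (K N : nat) (S : scheme R (prodV V) U K N).
Variables (T : nat) (a : 'M[F]_(N, K)) (b : 'M[F]_(N, T)).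
Hypothesis encS : enc S =1 fdist_map (linear_encoder a b) (fdist_unif R (keys_gt0 V T)).

Lemma fdist_unif_neq0 (A : finType) (A0 : (0 < #|A|)%N) x : fdist_unif R A0 x != 0.
Proof. by rewrite /= invr_eq0 pnatr_eq0 -lt0n. Qed.

Lemma enc_linear_encoder Z : enc S (linear_encoder a b Z) != 0.
Proof. by rewrite encS; apply/fdist_map_neq0; exists Z; rewrite // fdist_unif_neq0. Qed.

(** Any decoder of positive probability can be fixed: an event of probability one holds at every
    atom, and every choice of keys yields an encoder of positive probability. *)
Lemma valid_decoder (g : prodV V -> U) f :
  valid g f S ->
  exists l : {ffun 'I_N -> U} -> U, forall X Z,
    l [ffun i => g (linear_encoder a b Z i X)] = f X.
Proof.
move=> vS; have [l ln0] := fdist_ex _ _ (dec S); exists l => X Z.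
have := Pr_eq1 _ _ _ _ (linear_encoder a b Z, l) (vS X) => /= h; apply/eqP/h.
by rewrite mulf_neq0 ?enc_linear_encoder.
Qed.

(** Without keys the stored value is a function [phi] of the dataset, which privacy under uniform
    data forces to be constant. Comparing the zero dataset with the one having [v] only at position
    [k] gives [a i k = 0]. *)
Lemma private_row i (v : prodV V) j :
  v j != 0 -> data_private S -> row i b = 0 -> row i a = 0.
Proof.
move=> vj pS bi0; apply/rowP => k; rewrite !mxE.
pose phi (X : dataset (prodV V) K) : prodV V :=
  finfun (fun j => \sum_k a i k *: X k j).
have encE Z X : linear_encoder a b Z i X = phi X.
  rewrite !ffunE; apply/ffunP => j'; rewrite !ffunE [X in _ + X]big1 ?addr0 // => t _.
  by move/rowP/(_ t): bi0; rewrite !mxE => ->; rewrite scale0r.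
have data0 : (0 < #|{: dataset (prodV V) K}|)%N by apply/card_gt0P; exists [ffun=> v].
have := pS i (fdist_unif R data0); set P := fdist_map _ _ => I0.
have Pphi p : P p != 0 -> p.2 = phi p.1.
  case/fdist_map_neq0 => -[X h] /= <-; rewrite mulf_eq0 negb_or => /andP[_].
  by rewrite encS => /fdist_map_neq0[Z <- _] /=; rewrite encE.
have Pn0 X : P (X, phi X) != 0.
  apply/fdist_map_neq0; exists (X, linear_encoder a b [ffun=> v]).
    by rewrite /= encE.
  by rewrite mulf_neq0 ?fdist_unif_neq0 ?enc_linear_encoder.
pose X0 : dataset (prodV V) K := [ffun=> finfun (fun=> 0)].
pose X1 : dataset (prodV V) K := [ffun k' => if k' == k then v else finfun (fun=> 0)].
have := mutual_info_det_eq0 _ _ _ _ _ Pphi I0 _ _ (Pn0 X0) (Pn0 X1).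
move=> /= /ffunP/(_ j); rewrite !ffunE big1 => [|k' _]; last by rewrite !ffunE scaler0.
rewrite (bigD1 k) //= big1 => [|k' /negPf kk']; last by rewrite !ffunE kk' ffunE scaler0.
rewrite !ffunE eqxx addr0 => /esym/eqP; rewrite scaler_eq0 (negPf vj) orbF.
by move/eqP.
Qed.

End Schemes.

(** * The lower bound on the number of workers *)

Theorem lemma2 (K d : nat) (hK : (1 <= K)%N) (hd : (1 <= d)%N) :
  exists q0 : nat,
    forall (R : realType) (F : finFieldType), (q0 <= #|F|)%N ->
    forall (V : 'I_d -> vectType F) (U : vectType F)
           (g : prodV V -> finvect_type U),
      multilinear g ->
      (exists v : prodV V, g v != 0) ->
    forall (N : nat) (S : scheme R (prodV V) (finvect_type U) K N),
      valid g (fun X : dataset (prodV V) K => \sum_(k < K) g (X k)) S ->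
      data_private S ->
      uses_linear_encoding S ->
      (K * (d - 1) + 2 <= N)%N.
Proof.
(* The bound [K.+1] ensures that the [K] data coordinates are fewer than the field elements. *)
case: d hd => // p _; exists K.+1 => R F ltKF V U g gL [v gv] N S vS pS [T [a [b encS]]].
rewrite subn1 /= addn2 ltnNge; apply/negP => leN.
have v0 : v ord0 != 0.
  apply: contraNneq gv => v0; pose c j : F := if j == ord0 :> 'I_p.+1 then 0 else 1.
  have := multilinear_scale _ _ _ _ g c v gL; rewrite big_ord_recl /= mul0r scale0r.
  move=> <-; apply/eqP; congr (g _); apply/ffunP => j; rewrite ffunE /c.
  by case: eqVneq => [->|_]; rewrite ?v0 ?scaler0 ?scale1r.
pose L := row_mx a b; pose D : {set 'I_(K + T)} := [set lshift T k | k : 'I_K].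
have cD : #|D| = K by rewrite card_imset ?card_ord //; exact: lshift_inj.
have privL i : row i L != 0 -> exists2 t, t \notin D & L i t != 0.
  move=> Li; have : row i b != 0.
    apply: contraNneq Li => bi; rewrite row_row_mx bi.
    by rewrite (private_row _ _ _ _ _ _ _ _ _ _ _ encS _ _ _ v0 pS bi) row_mx0.
  case/rV0Pn => t; rewrite mxE => bit; exists (rshift K t); last by rewrite row_mxEr.
  by apply/imsetP => -[k _ /eqP]; rewrite eq_sym eq_lrshift.
have [|||ss [y [k0 [sz k0D ssk yD yL]]]] := fooling_vectors F N _ L D p _ privL.
- by rewrite cD.
- by apply/set0Pn; exists (lshift T (Ordinal hK)); apply: imset_f.
- by rewrite cD addn1.
have [l lE] := valid_decoder _ _ _ _ _ _ _ _ _ _ _ encS _ _ vS.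
(* The default of [nth] is [z]: as [size ss = p], the first [p] arguments come from [ss] and the
   last one is [z]. *)
pose s (z : 'cV[F]_(K + T)) (j : 'I_p.+1) := nth z ss j.
pose X z : dataset (prodV V) K :=
  [ffun k => finfun (fun j => s z j (lshift T k) 0 *: v j)].
pose Z z : {ffun 'I_T -> prodV V} :=
  [ffun t => finfun (fun j => s z j (rshift K t) 0 *: v j)].
have prod_s z (h : 'cV[F]_(K + T) -> F) :
    \prod_j h (s z j) = (\prod_(x <- ss) h x) * h z.
  rewrite big_ord_recr /= /s nth_default ?sz //; congr (_ * _).
  by rewrite (big_nth z) sz big_mkord.
have gX z k : g (X z k) = ((\prod_(x <- ss) x (lshift T k) 0) * z (lshift T k) 0) *: g v.
  rewrite ffunE multilinear_scale //.
  by rewrite (prod_s z (fun x => x (lshift T k) 0)).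
have gL0 z i : (\prod_(x <- ss) (L *m x) i 0) * (L *m z) i 0 = 0 ->
    g (linear_encoder a b (Z z) i (X z)) = 0.
  move=> L0; transitivity (g (finfun (fun j => (L *m s z j) i 0 *: v j))).
    rewrite !ffunE; congr (g _); apply/ffunP => j; rewrite !ffunE.
    rewrite mxE big_split_ord /= scalerDl !scaler_suml.
    by congr (_ + _); apply: eq_bigr => k _; rewrite !ffunE scalerA ?row_mxEl ?row_mxEr.
  by rewrite multilinear_scale // (prod_s z (fun x => (L *m x) i 0)) L0 scale0r.
have lE0 z : (forall i, (\prod_(x <- ss) (L *m x) i 0) * (L *m z) i 0 = 0) ->
    \sum_(k < K) g (X z k) = l [ffun=> 0].
  move=> L0; rewrite -(lE (X z) (Z z)); congr (l _); apply/ffunP => i.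
  by rewrite [RHS]ffunE ffunE gL0.
(* Both [z = 0] and [z = y] make every worker return zero, so the master outputs the same value; the
   true sum is zero for the first and a nonzero multiple of [g v] for the second. *)
have := lE0 0; rewrite big1 => [l0|k _]; last by rewrite gX mxE mulr0 scale0r.
have := lE0 y yL; rewrite -l0 => [|i]; last by rewrite mulmx0 mxE mulr0.
have [k1 _ k01] := imsetP k0D.
rewrite (bigD1 k1) //= big1 => [|k kk1]; last first.
  rewrite gX yD ?imset_f // k01 (inj_eq (@lshift_inj _ _)) (negPf kk1).
  by rewrite mulr0 scale0r.
rewrite addr0 gX yD ?imset_f // k01 eqxx mulr1 -k01 => /eqP.
rewrite scaler_eq0 (negPf gv) orbF; apply/negP.
by rewrite prodf_seq_neq0; apply: sub_all ssk => x /= ->.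
Qed.
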